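(* Let $G$ be a finite simple graph, let $C$ be an induced cycle in $G$, and let $n\geq 2$ be an integer such that at most $n$ vertices of $C$ are adjacent to vertices of $G\setminus C$. Let $c$ be a number such that $\mathbf{c}(H)\leq c$ for every induced subgraph $H$ of $G\setminus C$. Then $\mathbf{c}(G)\leq c\,\ell(n)$.
   Context: For a finite simple graph $G$, its independence complex $\mathrm{Ind}(G)$ is the set of all independent vertex subsets of $G$ (including the empty set), partially ordered by inclusion. A matching on this poset is a set of pairs $\{\sigma,\tau\}$ of elements with $\tau$ covering $\sigma$ (i.e. $\sigma\subset\tau$, $|\tau|=|\sigma|+1$), such that distinct pairs are disjoint. A sequence of $n>1$ distinct pairs $\{\sigma_1\subset\tau_1\},\ldots,\{\sigma_n\subset\tau_n\}$ of the matching is a cycle if $\tau_i\supset\sigma_{i+1}$ for $1\leq i<n$ and $\tau_n\supset\sigma_1$; the matching is acyclic if it has no cycles. Elements of $\mathrm{Ind}(G)$ not in any matched pair are critical. $\mathbf{c}(G)$ denotes the minimal number of critical elements over all acyclic matchings on $\mathrm{Ind}(G)$. $G\setminus C$ denotes the induced subgraph on the vertices not in $C$. The Fibonacci numbers are $\varphi(0)=0$, $\varphi(1)=1$, $\varphi(n)=\varphi(n-1)+\varphi(n-2)$, and the Lucas numbers are $\ell(n)=\varphi(n-1)+\varphi(n+1)$. *)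

(* Defs.v *)
From mathcomp Require Import all_boot all_order.
From mathcomp Require Import boolp.
Set Implicit Arguments. Unset Strict Implicit. Unset Printing Implicit Defensive.

Section Defs.
Variables (T : finType) (e : rel T).

Definition simple_graph := symmetric e /\ irreflexive e.

Definition indep (s : {set T}) : bool := [forall x in s, forall y in s, ~~ e x y].
Definition Ind (V : {set T}) : {set {set T}} := [set s : {set T} | (s \subset V) && indep s].

Definition matching (V : {set T}) (M : {set ({set T} * {set T})}) : bool :=
  [forall p in M, [&& p.1 \in Ind V, p.2 \in Ind V, p.1 \subset p.2 & #|p.2| == #|p.1|.+1]] &&
  [forall p in M, forall q in M,
     (p != q) ==> [&& p.1 != q.1, p.1 != q.2, p.2 != q.1 & p.2 != q.2]].

Definition is_cycle (M : {set ({set T} * {set T})}) (s : seq ({set T} * {set T})) : Prop :=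
  [/\ 1 < size s, uniq s, all (fun p => p \in M) s &
      forall i, i < size s ->
        (nth (set0, set0) s (i.+1 %% size s)).1 \subset (nth (set0, set0) s i).2].

Definition acyclic (M : {set ({set T} * {set T})}) : Prop := forall s, ~ is_cycle M s.

Definition acyclic_matching V M : Prop := matching V M /\ acyclic M.

Definition critical (V : {set T}) (M : {set ({set T} * {set T})}) : {set {set T}} :=
  [set s in Ind V | [forall p in M, (p.1 != s) && (p.2 != s)]].

(* c(G[V]) : minimum number of critical elements over all acyclic matchings
   (the empty matching gives the bound #|Ind V|). *)
Definition cmin (V : {set T}) : nat :=
  \big[minn/#|Ind V|]_(M : {set ({set T} * {set T})} | `[< acyclic_matching V M >])
     #|critical V M|.

Definition induced_cycle (C : {set T}) : Prop :=
  exists (k : nat) (f : 'I_k -> T), [/\ 3 <= k, injective f, C = f @: setT &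
    forall i j : 'I_k, e (f i) (f j) = (j == i.+1 %% k :> nat) || (i == j.+1 %% k :> nat)].

Definition n_attach (C : {set T}) : nat :=
  #|[set x in C | [exists y, (y \notin C) && e x y]]|.

End Defs.

Fixpoint fib (n : nat) : nat :=
  match n with 0 => 0 | 1 => 1 | (m.+1 as p).+1 => fib p + fib m end.
Definition lucas (n : nat) : nat := fib n.-1 + fib n.+1.

(* Main.v *)
(** Deleting a vertex v or its closed neighbourhood gives
    c(G) <= c(G - v) + c(G - N[v]), and c(G) = 0 when G has an isolated vertex;
    hence c(G) <= c(G - N[v]) when v is the neighbour of a leaf.  For a segment
    of C with a vertices attached to G - C, branching at attached end vertices
    and removing three vertices at unattached ones yields the bound
    c * phi(a + 2), uniformly over the part of G - C which is kept.  If the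
    cycle has m >= 2 attached vertices, branching at one of them leaves a
    segment with m - 1 attached vertices and the same segment without its two
    ends; these together contribute at most
    c * (phi(m + 1) + phi(m - 1)) = c * l(m). *)
Require Import Defs.
From mathcomp Require Import all_boot all_order boolp zify.
Set Implicit Arguments. Unset Strict Implicit. Unset Printing Implicit Defensive.

(** * Relations that close up cyclically, and minima of finite families *)

Lemma cyclic_transitive (X : Type) (r : rel X) (h : nat -> X) (n : nat) :
  reflexive r -> transitive r ->
  (forall i, i < n -> r (h (i.+1 %% n)) (h i)) ->
  forall i j, i < n -> j < n -> r (h i) (h j).
Proof.
move=> rR rT hr.
have down d i : i + d < n -> r (h (i + d)) (h i).
  elim: d => [|d IHd] lt_id; first by rewrite addn0.
  have lt_id' : i + d < n by lia.
  apply: rT (IHd lt_id').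
  by have := hr _ lt_id'; rewrite modn_small ?addnS // -addnS.
have le_r i j : i <= j -> j < n -> r (h j) (h i).
  by move=> le_ij lt_jn; rewrite -(subnKC le_ij); apply: down; rewrite subnKC.
move=> i j lt_in lt_jn.
(* The path runs from [i] down to 0, crosses to [n.-1] by the closing step of the cycle, and runs
   down to [j]. *)
apply: (rT (h 0)); first exact: le_r.
apply: (rT (h n.-1)); last by apply: le_r; lia.
have lt_n : n.-1 < n by lia.
by have := hr _ lt_n; rewrite prednK ?modnn //; lia.
Qed.

Lemma bigminn_le (I : eqType) (r : seq I) (P : pred I) (F : I -> nat) x i :
  i \in r -> P i -> \big[minn/x]_(j <- r | P j) F j <= F i.
Proof.
move=> + Pi; elim: r => //= a r IHr; rewrite in_cons big_cons.
case/predU1P => [<-|/IHr le_i]; first by rewrite Pi geq_minl.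
by case: (P a) => //; apply: leq_trans (geq_minr _ _) le_i.
Qed.

(** * Acyclic matchings on independence complexes *)

Section IndependenceComplex.
Variables (T : finType) (e : rel T).
Hypothesis simple_e : simple_graph e.

Implicit Types (u v : T) (s t V : {set T}) (p q : {set T} * {set T})
  (M : {set {set T} * {set T}}).

Lemma indepP s : reflect {in s &, forall x y, ~~ e x y} (indep e s).
Proof.
apply: (iffP forall_inP) => [ind_s x y xs ys | ind_s x xs].
  exact: (forall_inP (ind_s x xs)).
by apply/forall_inP => y; apply: ind_s.
Qed.

Lemma mem_Ind V s : s \in Ind e V = (s \subset V) && indep e s.
Proof. by rewrite inE. Qed.

Lemma indepS s t : s \subset t -> indep e t -> indep e s.
Proof.
move=> /subsetP sub_st /indepP ind_t.
by apply/indepP => x y /sub_st xt /sub_st; apply: ind_t.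
Qed.

Lemma indepU1 v s : indep e (v |: s) = [forall x in s, ~~ e v x] && indep e s.
Proof.
case: simple_e => symm_e irr_e.
apply/indepP/andP => [ind_vs | [/forall_inP nbr_v /indepP ind_s] x y].
  split; last first.
    by apply/indepP => x y xs ys; apply: ind_vs; rewrite in_setU1 ?xs ?ys orbT.
  by apply/forall_inP => x xs; apply: ind_vs; rewrite !inE ?eqxx // xs orbT.
case/setU1P => [->|xs] /setU1P [->|ys]; rewrite ?irr_e ?nbr_v //.
  by rewrite symm_e nbr_v.
exact: ind_s.
Qed.

Lemma matchingP V M :
  reflect
    ((forall p, p \in M ->
        [/\ p.1 \in Ind e V, p.2 \in Ind e V, p.1 \subset p.2 & #|p.2| = #|p.1|.+1]) /\
     (forall p q, p \in M -> q \in M -> p != q ->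
        [/\ p.1 != q.1, p.1 != q.2, p.2 != q.1 & p.2 != q.2]))
    (matching e V M).
Proof.
rewrite /matching; apply: (iffP andP) => -[].
  move=> /forall_inP cov /forall_inP dis; split=> [p /cov /and4P[-> -> -> /eqP->] //|].
  by move=> p q pM qM /(implyP (forall_inP (dis p pM) q qM)) /and4P.
move=> cov dis; split; apply/forall_inP => p pM.
  by have [-> -> -> /eqP] := cov p pM.
by apply/forall_inP => q qM; apply/implyP => /(dis p q pM qM) /and4P.
Qed.

Lemma criticalP V M s :
  reflect (s \in Ind e V /\ forall p, p \in M -> p.1 != s /\ p.2 != s)
    (s \in critical e V M).
Proof.
have -> : (s \in critical e V M) = (s \in Ind e V) && [forall p in M, (p.1 != s) && (p.2 != s)].
  by rewrite [LHS]in_set.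
apply: (iffP andP) => -[-> H]; split=> //.
  by move=> p pM; apply/andP; apply: (forall_inP H).
by apply/forall_inP => p /H [-> ->].
Qed.

Lemma cmin_le V M : acyclic_matching e V M -> cmin e V <= #|critical e V M|.
Proof. by move=> /asboolP amM; apply: bigminn_le => //; rewrite mem_index_enum. Qed.

Lemma cmin_attained V :
  exists2 M, acyclic_matching e V M & #|critical e V M| <= cmin e V.
Proof.
apply: (big_ind (fun x => exists2 M, acyclic_matching e V M & #|critical e V M| <= x)).
(* The default value of the minimum is reached by the empty matching. *)
- exists set0; last by apply/subset_leq_card/subsetP => s /criticalP[].
  split; first by apply/matchingP; split=> [p|p q]; rewrite inE.
  by move=> [|p s] [] //= _ _ /andP[]; rewrite inE.
- by move=> x y [M1 am1 le1] [M2 am2 le2]; rewrite /minn; case: ifP; [exists M1 | exists M2].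
- by move=> M /asboolP amM; exists M.
Qed.

(** An isolated vertex is a cone point of the complex: toggling [u] pairs off all independent
    sets. *)
Lemma cmin_isolated V u : u \in V -> {in V, forall x, ~~ e u x} -> cmin e V = 0.
Proof.
move=> uV iso_u; apply/eqP; rewrite -leqn0.
pose M := [set (s, u |: s) | s in Ind e (V :\ u)].
have MP p : p \in M -> [/\ p.2 = u |: p.1, u \notin p.1, p.1 \in Ind e V & p.2 \in Ind e V].
  case/imsetP => s sInd -> /=; move: sInd.
  rewrite (mem_Ind _ s) subsetD1 => /andP[/andP[sV us] ind_s].
  rewrite !mem_Ind sV ind_s subUset sub1set uV sV indepU1 ind_s !andbT; split=> //=.
  by apply/forall_inP => x /(subsetP sV); apply: iso_u.
have subM p q : p \in M -> q \in M -> q.1 \subset p.2 -> q.1 \subset p.1.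
  move=> /MP[-> up _ _] /MP[_ uq _ _] /(setSD [set u]).
  by rewrite setU1K // (setDidPl _) // disjoint_sym disjoints1.
have inj1 p q : p \in M -> q \in M -> p.1 = q.1 -> p = q.
  by case: p q => [p1 p2] [q1 q2] /MP[/= -> _ _ _] /MP[/= -> _ _ _] ->.
suff [amM crit0] : acyclic_matching e V M /\ critical e V M = set0.
  by apply: leq_trans (cmin_le amM) _; rewrite crit0 cards0.
split; last first.
  apply/setP => s; rewrite in_set0; apply/negP => /criticalP[sInd noM].
  case us : (u \in s).
    have sM : (s :\ u, s) \in M.
      apply/imsetP; exists (s :\ u); last by rewrite setD1K.
      move: sInd; rewrite !mem_Ind => /andP[sV ind_s].
      by rewrite setSD // (indepS _ ind_s) // subD1set.
    by have [_ /eqP] := noM _ sM.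
  have sM : (s, u |: s) \in M.
    apply/imsetP; exists s => //.
    by move: sInd; rewrite !mem_Ind subsetD1 us andbT.
  by have [/eqP] := noM _ sM.
split.
  apply/matchingP; split=> [p pM|p q pM qM neq_pq].
    have [-> up p1I p2I] := MP _ pM; rewrite p1I subsetU1 cardsU1 up.
    by case: (MP _ pM) => <-.
  have neq1 : p.1 != q.1 by apply: contra_neq neq_pq; apply: inj1.
  have [-> up _ _] := MP _ pM; have [-> uq _ _] := MP _ qM; split=> //.
  - by apply: contraNneq up => ->; rewrite setU11.
  - by apply: contraNneq uq => <-; rewrite setU11.
  by apply: contra_neq neq1 => eqU; rewrite -(setU1K up) eqU setU1K.
(* By [subM] the lower sets shrink all the way around a cycle, so they are equal. A lower set
   determines its pair by [inj1], which contradicts the distinctness of the pairs. *)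
move=> s [size_s uniq_s /allP sM cyc_s].
pose h i := (nth (set0, set0) s i).1.
have nthM i : i < size s -> nth (set0, set0) s i \in M by move=> ?; apply/sM/mem_nth.
have sub_h i j : i < size s -> j < size s -> h i \subset h j.
  apply: (@cyclic_transitive _ (fun a b => a \subset b) h (size s)) => [a|a b c|k lt_k] //.
    exact: subset_trans.
  apply: subM (cyc_s k lt_k); apply: nthM => //.
  by rewrite ltn_mod; lia.
have lt0 : 0 < size s by lia.
have := inj1 _ _ (nthM _ lt0) (nthM _ size_s).
have -> : (nth (set0, set0) s 0).1 = (nth (set0, set0) s 1).1.
  by apply/eqP; rewrite eqEsubset !sub_h.
move=> /(_ erefl)/eqP; rewrite nth_uniq //.
Qed.

(* The sets of the two parts form a down-set and an up-set of Ind(V), so a cycle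
   of the union of two matchings stays in one part. *)
Lemma cmin_split V v : v \in V ->
  cmin e V <= cmin e (V :\ v) + cmin e (V :\: (v |: [set y | e v y])).
Proof.
move=> vV; set V1 := V :\ v; set V2 := V :\: _.
have [M1 [/matchingP[cov1 dis1] acy1] le1] := cmin_attained V1.
have [M2 [/matchingP[cov2 dis2] acy2] le2] := cmin_attained V2.
(* [V2] omits the closed neighbourhood of [v], so its independent sets stay independent when [v] is
   added, and [lift] carries [M2] to the sets containing [v]. *)
pose lift p := (v |: p.1, v |: p.2).
pose lower p := (p.1 :\ v, p.2 :\ v).
have vN1 s : s \in Ind e V1 -> v \notin s.
  by rewrite mem_Ind subsetD1 => /andP[/andP[]].
have vN2 s : s \in Ind e V2 -> v \notin s.
  rewrite mem_Ind => /andP[/subsetP sV2 _]; apply/negP => /sV2.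
  by rewrite in_setD setU11.
have sub1 s : s \in Ind e V1 -> s \in Ind e V.
  by rewrite !mem_Ind subsetD1 => /andP[/andP[-> _] ->].
have Ind2 s : v \notin s -> (s \in Ind e V2) = (v |: s \in Ind e V).
  move=> vs; rewrite !mem_Ind indepU1 subUset sub1set vV subsetD -!andbA /=.
  congr [&& _, _ & _].
  rewrite disjoint_sym; apply/pred0P/forall_inP => [dis x xs | nbr x].
    by have := dis x; rewrite !inE xs andbT => /norP[].
  rewrite !inE; apply/negP => /andP[/predU1P[->|vx]]; first by rewrite (negPf vs).
  by move/nbr; rewrite vx.
pose M := M1 :|: lift @: M2.
have lowerK p : p \in M2 -> lower (lift p) = p.
  move=> pM; have [/vN2 v1 /vN2 v2 _ _] := cov2 _ pM.
  by rewrite /lower /lift /= !setU1K //; case: (p).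
have in1 p : p \in M1 -> v \notin p.1 /\ v \notin p.2.
  by case/cov1 => /vN1 ? /vN1.
have in2 p : p \in M -> v \in p.1 -> p \in lift @: M2.
  by case/setUP => // /in1[/negPf->].
have in2' p : p \in M -> v \in p.2 -> p \in lift @: M2.
  by case/setUP => // /in1[_ /negPf->].
have notin2 p : p \in M -> v \notin p.1 -> p \in M1.
  by case/setUP => // /imsetP[q _ ->]; rewrite setU11.
have amM : acyclic_matching e V M.
  split.
    apply/matchingP; split.
      move=> p0 /setUP[p0M|/imsetP[p pM ->{p0}]] /=.
        by have [s1 s2 sub_p card_p] := cov1 _ p0M; rewrite !sub1.
      have [p1 p2 sub_p card_p] := cov2 _ pM.
      rewrite -!Ind2 ?vN2 // setUS // !cardsU1 !vN2 //= card_p.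
      by split.
    move=> p q /setUP[pM|/imsetP[p' pM ->]] /setUP[qM|/imsetP[q' qM ->]] neq_pq.
    - exact: dis1.
    - have [v1 v2] := in1 _ pM.
      split=> /=; [move: v1|move: v1|move: v2|move: v2];
        by apply: contraNneq => ->; rewrite setU11.
    - have [v1 v2] := in1 _ qM.
      split=> /=; [move: v1|move: v2|move: v1|move: v2];
        by apply: contraNneq => <-; rewrite setU11.
    have [/vN2 vp1 /vN2 vp2 _ _] := cov2 _ pM.
    have [/vN2 vq1 /vN2 vq2 _ _] := cov2 _ qM.
    have [|] := dis2 p' q' pM qM; first by apply: contra_neq neq_pq => ->.
    have inj (a b : {set T}) : v \notin a -> v \notin b -> a != b -> v |: a != v |: b.
      by move=> va vb; apply: contra_neq => eqU; rewrite -(setU1K va) eqU setU1K.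
    by move=> *; split; apply: inj.
  move=> s [size_s uniq_s /allP sM cyc_s].
  have nthM i : i < size s -> nth (set0, set0) s i \in M by move=> ?; apply/sM/mem_nth.
  have lt0 : 0 < size s by lia.
  pose h i := v \in (nth (set0, set0) s i).1.
  (* If [v] lies in a lower set of the cycle, it lies in the preceding upper set. That pair is then
     lifted, so [v] lies in its lower set too, and the property travels around the cycle. *)
  have const_h i : i < size s -> h i = h 0.
    have mono_h := @cyclic_transitive _ implb h (size s).
    move=> lt_i; suff imp j k : j < size s -> k < size s -> h j ==> h k.
      by apply/idP/idP; apply/implyP/imp.
    apply: mono_h => [[]|[] [] []|l lt_l] //.
    apply/implyP => /(subsetP (cyc_s l lt_l)) /(in2' _ (nthM _ lt_l)) /imsetP[q _].
    by rewrite /h => ->; rewrite setU11.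
  (* With [v] present throughout, removing it gives a cycle of [M2]; otherwise the cycle lies in
     [M1]. *)
  case h0 : (h 0).
    have s2 p : p \in s -> p \in lift @: M2.
      move=> ps; apply: in2; first exact: sM.
      by have := const_h _ (etrans (index_mem p s) ps); rewrite /h nth_index // => ->.
    have s2K : {in s, cancel lower lift}.
      by move=> _ /s2 /imsetP[q qM ->]; rewrite lowerK.
    apply: (acy2 (map lower s)); split.
    - by rewrite size_map.
    - rewrite map_inj_in_uniq // => p q ps qs eq_pq.
      by rewrite -(s2K p) // eq_pq s2K.
    - apply/allP => _ /mapP[p /s2 /imsetP[q qM ->] ->].
      by rewrite lowerK.
    rewrite size_map => i lt_i.
    rewrite !(nth_map (set0, set0)) ?ltn_mod //.
    by rewrite /lower /= setSD // cyc_s.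
  apply: (acy1 s); split=> //; apply/allP => p ps; apply: notin2; first exact: sM.
  by have := const_h _ (etrans (index_mem p s) ps); rewrite /h nth_index // => ->; rewrite -/(h 0) h0.
apply: leq_trans (cmin_le amM) _.
apply: leq_trans (leq_add le1 le2).
have crit_sub : critical e V M \subset
    critical e V1 M1 :|: [set v |: s | s in critical e V2 M2].
  apply/subsetP => s /criticalP[sV noM]; apply/setUP.
  case vs : (v \in s); [right | left].
    apply/imsetP; exists (s :\ v); last by rewrite setD1K.
    apply/criticalP; split; first by rewrite Ind2 ?setD1K // setD11.
    move=> p pM; have [|n1 n2] := noM (lift p); first by rewrite in_setU imset_f ?orbT.
    by split; [apply: contra_neq n1 | apply: contra_neq n2] => /= ->; rewrite setD1K.
  apply/criticalP; split; last by move=> p pM; apply: noM; rewrite in_setU pM.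
  by move: sV; rewrite !mem_Ind subsetD1 vs andbT.
apply: leq_trans (subset_leq_card crit_sub) _.
by apply: leq_trans (leq_card_setU _ _) _; rewrite leq_add2l leq_imset_card.
Qed.

(** Deleting [v] isolates [u], so the first term of [cmin_split] vanishes. *)
Lemma cmin_leaf V u v : u \in V -> v \in V -> e u v ->
  {in V, forall x, e u x -> x = v} ->
  cmin e V <= cmin e (V :\: (v |: [set y | e v y])).
Proof.
move=> uV vV uv leaf_u; apply: leq_trans (cmin_split vV) _.
rewrite (@cmin_isolated _ u) //.
  by rewrite !inE uV andbT; apply: contraTneq uv => ->; rewrite (simple_e.2 v).
by move=> x; rewrite !inE => /andP[neq_xv xV]; apply: contra neq_xv => /(leaf_u _ xV)->.
Qed.

End IndependenceComplex.

(** * Fibonacci bounds for a recursion on segments *)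

Lemma fibSS m : fib m.+2 = fib m.+1 + fib m.
Proof. by []. Qed.

Lemma leq_fib m n : m <= n -> fib m <= fib n.
Proof.
move: m n; apply: (homo_leq leqnn leq_trans) => -[|m] //.
by rewrite fibSS leq_addr.
Qed.

Section Segments.
(* [A i j] stands for [segment_cmin i j] below: the largest value of [cmin] over
   the unions of the cycle vertices of index [i <= t < j] and a set outside C. *)
Variables (att : nat -> bool) (A : nat -> nat -> nat) (k c : nat).

Definition natt i j := \sum_(i <= t < j) att t.

Hypothesis A_empty : forall i j, 0 < i -> j <= k -> j <= i -> A i j <= c.
Hypothesis A_branch : forall i j, 0 < i -> j <= k -> i < j ->
  A i j <= A i.+1 j + A i.+2 j.
Hypothesis A_single : forall i, 0 < i -> i < k -> ~~ att i -> A i i.+1 = 0.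
Hypothesis A_leafl : forall i j, 0 < i -> j <= k -> i.+1 < j -> ~~ att i ->
  A i j <= A i.+3 j.
Hypothesis A_leafr : forall i j, 0 < i -> j <= k -> i.+1 < j -> ~~ att j.-1 ->
  A i j <= A i (j - 3).

Local Notation F x := (c * fib x).

Lemma nattl i j : i < j -> natt i j = att i + natt i.+1 j.
Proof. by move=> lt_ij; rewrite /natt big_ltn. Qed.

Lemma nattr i j : i < j -> natt i j = natt i j.-1 + att j.-1.
Proof. by case: j => // j lt_ij; rewrite /natt big_nat_recr. Qed.

Lemma natt_geq i j : j <= i -> natt i j = 0.
Proof. by move=> le_ji; rewrite /natt big_geq. Qed.

Lemma nattl0 i j : ~~ att i -> natt i j = natt i.+1 j.
Proof.
move=> ui; case: (ltnP i j) => [lt_ij|le_ji]; first by rewrite nattl // (negPf ui).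
by rewrite !natt_geq // leqW.
Qed.

Lemma nattr0 i j : ~~ att j.-1 -> natt i j = natt i j.-1.
Proof.
move=> uj; case: (ltnP i j) => [lt_ij|le_ji]; first by rewrite nattr // (negPf uj) addn0.
by rewrite !natt_geq //; lia.
Qed.

Lemma leq_nattl i i' j : i <= i' -> natt i' j <= natt i j.
Proof.
move=> le_ii; case: (leqP i' j) => [le_ij|/ltnW/natt_geq->] //.
by rewrite /natt (big_cat_nat le_ii le_ij) leq_addl.
Qed.

Lemma leq_nattr i j j' : j' <= j -> natt i j' <= natt i j.
Proof.
move=> le_jj; case: (leqP i j') => [le_ij|/ltnW/natt_geq->] //.
by rewrite /natt (big_cat_nat le_ij le_jj) leq_addr.
Qed.

Lemma leF m n : m <= n -> F m <= F n.
Proof. by move=> le_mn; rewrite leq_mul2l leq_fib ?orbT. Qed.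

Lemma FSS m : F m.+2 = F m.+1 + F m.
Proof. by rewrite fibSS mulnDr. Qed.

(* The second inequality is what branching at an attached vertex just before
   [i] requires: it drops either that vertex alone or [i] as well. *)
Lemma segment_and_pair_bound n i j : 0 < i -> j <= k -> j - i <= n ->
  A i j <= F (natt i j).+2 /\ A i j + A i.+1 j <= F (natt i j).+3.
Proof.
elim/ltn_ind: n i j => n IHn i j i0 jk le_n.
have F1 : F 1 = c by rewrite muln1.
have F2 : F 2 = c by rewrite muln1.
have F3 := FSS 1; have F4 := FSS 2.
case: (leqP j i) => [le_ji|lt_ij].
  rewrite natt_geq //; have := A_empty i0 jk le_ji.
  by have := @A_empty i.+1 j; lia.
have IH i' : i < i' ->
    A i' j <= F (natt i' j).+2 /\ A i' j + A i'.+1 j <= F (natt i' j).+3.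
  move=> lt_ii; case: (leqP j i') => [le_ji|lt_ij'].
    rewrite natt_geq //; have := @A_empty i' j; have := @A_empty i'.+1 j; lia.
  by apply: (IHn (j - i')); lia.
have le2 := leF (leq_addr 1 (natt i j).+2); rewrite addn1 in le2.
have [P1 Q1] := IH _ (ltnSn i).
(* If [i] is attached, branching produces exactly the pair bounded by [Q1], and the Fibonacci
   recurrence gives the second inequality. *)
case att_i : (att i).
  have natt_i : natt i j = (natt i.+1 j).+1 by rewrite nattl // att_i.
  have := A_branch i0 jk lt_ij; rewrite natt_i.
  have := FSS (natt i.+1 j).+2; lia.
have natt_i : natt i j = natt i.+1 j by rewrite nattl // att_i.
case: (eqVneq i.+1 j) => [eq_ij|neq_ij].
  have -> : A i j = 0 by rewrite -eq_ij A_single ?att_i //; lia.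
  by rewrite natt_i; lia.
have leaf_i : A i j <= A i.+3 j by rewrite A_leafl ?att_i //; lia.
have [P3 Q3] : A i.+3 j <= F (natt i.+3 j).+2 /\
    A i.+3 j + A i.+4 j <= F (natt i.+3 j).+3 by apply: IH; lia.
have le_natt3 : natt i.+3 j <= natt i.+2 j by apply: leq_nattl.
have le_natt2 : natt i.+2 j <= natt i.+1 j by apply: leq_nattl.
split; first by apply: leq_trans leaf_i (leq_trans P3 (leF _)); lia.
(* An attached [i.+1] is among the vertices removed at the leaf [i], so [A i j] is bounded one
   Fibonacci index lower than [A i.+1 j]. *)
case att_i1 : (att i.+1).
  have natt_i1 : natt i.+1 j = (natt i.+2 j).+1 by rewrite nattl ?att_i1 //; lia.
  have : A i.+3 j <= F (natt i.+2 j).+2 by apply: leq_trans P3 (leF _).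
  rewrite natt_i natt_i1; rewrite natt_i1 in P1.
  by have := FSS (natt i.+2 j).+2; lia.
have natt_i1 : natt i.+1 j = natt i.+2 j by rewrite nattl ?att_i1 //; lia.
case: (eqVneq i.+2 j) => [eq_ij|neq_ij2].
  have -> : A i.+1 j = 0 by rewrite -eq_ij A_single ?att_i1 //; lia.
  have := @A_empty i.+3 j.
  have := leF (isT : 3 <= (natt i j).+3); lia.
(* With [i] and [i.+1] both unattached, the pair shifts by three and [Q3] applies. *)
have leaf_i1 : A i.+1 j <= A i.+4 j by rewrite A_leafl ?att_i1 //; lia.
have : F (natt i.+3 j).+3 <= F (natt i j).+3 by apply: leF; lia.
lia.
Qed.

Lemma segment_bound i j m : 0 < i -> j <= k -> natt i j <= m -> A i j <= F m.+2.
Proof.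
move=> i0 jk le_m.
have [bound _] := segment_and_pair_bound i0 jk (leqnn _).
by apply: leq_trans bound (leF _).
Qed.

(* An unattached pair at one end lets both summands lose three vertices there, so
   by induction at most one unattached vertex precedes the first attached one at
   each end.  The bound fails without attached vertices, where both summands can
   equal [c]. *)
Lemma segment_and_interior_bound i j m : 0 < i -> j <= k -> natt i j = m.+1 ->
  A i j + A i.+1 j.-1 <= F m.+3 + F m.+1.
Proof.
move: {2}(j - i) (leqnn (j - i)) => n.
elim/ltn_ind: n i j m => n IHn i j m le_n i0 jk natt_ij.
have lt_ij : i < j by rewrite ltnNge; apply/negP => /natt_geq; rewrite natt_ij.
have j1k : j.-1 <= k by lia.
(* This is 2 phi(m+2) <= phi(m+3) + phi(m+1), which reduces to phi(m) <= phi(m+1). It serves when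
   each summand has lost an attached vertex. *)
have two x y : x <= F m.+2 -> y <= F m.+2 -> x + y <= F m.+3 + F m.+1.
  have := FSS m.+1; have := FSS m; have := leF (leqnSn m); lia.
have lower_bounds x y : x <= F m.+1 -> y <= F m.+3 -> x + y <= F m.+3 + F m.+1.
  by lia.
have leF1 x : x <= c -> x <= F m.+1.
  by move=> le_xc; apply: leq_trans le_xc _; rewrite -{1}(muln1 c) (@leF 1).
have interior : A i.+1 j.-1 <= F m.+3.
  apply: segment_bound => //; rewrite -natt_ij.
  by apply: leq_trans (leq_nattl _ (leqnSn i)) (leq_nattr _ (leq_pred j)).
have stripl : ~~ att i -> ~~ att i.+1 -> A i j + A i.+1 j.-1 <= F m.+3 + F m.+1.
  move=> ui ui1; have nattE : natt i.+2 j = m.+1 by rewrite -!nattl0.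
  have lt2 : i.+2 < j by rewrite ltnNge; apply/negP => /natt_geq; rewrite nattE.
  case: (eqVneq i.+2 j.-1) => [eq2|neq2].
    have -> : A i.+1 j.-1 = 0 by rewrite -eq2 A_single //; lia.
    rewrite addn0.
    by apply: leq_trans (leq_addr _ _); apply: segment_bound; rewrite ?natt_ij.
  have leaf : A i j <= A i.+3 j by apply: A_leafl => //; lia.
  have leaf1 : A i.+1 j.-1 <= A i.+4 j.-1 by apply: A_leafl => //; lia.
  apply: leq_trans (leq_add leaf leaf1) _.
  (* The third removed vertex decides: if it is unattached, the count is unchanged and induction
     applies; if it is attached, both summands drop to [m]. *)
  have := nattl lt2; rewrite nattE; case: (att i.+2) => natt3; last first.
    by apply: (IHn (j - i.+3)) => //; lia.
  apply: two; apply: segment_bound => //; first by lia.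
  apply: leq_trans (leq_nattl _ (leqnSn i.+3)) _.
  by apply: leq_trans (leq_nattr _ (leq_pred j)) _; lia.
have stripr : ~~ att j.-1 -> ~~ att j.-2 -> A i j + A i.+1 j.-1 <= F m.+3 + F m.+1.
  move=> uj uj1; have nattE : natt i j.-2 = m.+1 by rewrite -!nattr0.
  have lt2 : i < j.-2 by rewrite ltnNge; apply/negP => /natt_geq; rewrite nattE.
  case: (eqVneq i.+1 j.-2) => [eq2|neq2].
    have -> : A i.+1 j.-1 = 0.
      have -> : j.-1 = i.+2 by lia.
      by apply: A_single; [|lia|rewrite eq2].
    rewrite addn0.
    by apply: leq_trans (leq_addr _ _); apply: segment_bound; rewrite ?natt_ij.
  have leaf : A i j <= A i (j - 3) by apply: A_leafr => //; lia.
  have leaf1 : A i.+1 j.-1 <= A i.+1 (j - 3).-1.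
    have -> : (j - 3).-1 = j.-1 - 3 by lia.
    by apply: A_leafr => //; lia.
  apply: leq_trans (leq_add leaf leaf1) _.
  have := nattr lt2; have -> : j.-2.-1 = j - 3 by lia.
  rewrite nattE; case: (att _) => natt3; last first.
    by apply: (IHn (j - 3 - i)); lia.
  apply: two; apply: segment_bound => //; try lia.
  apply: leq_trans (leq_nattl _ (leqnSn i)) _.
  by apply: leq_trans (leq_nattr _ (leq_pred _)) _; lia.
case ai : (att i).
  have natt1 : natt i.+1 j = m by move: natt_ij; rewrite nattl // ai; lia.
  case aj : (att j.-1).
    (* Both ends are attached, so the interior loses two attached vertices, or is empty when the
       ends coincide. *)
    rewrite addnC [X in _ <= X]addnC; apply: leq_add; last first.
      by apply: segment_bound; rewrite ?natt_ij.
    case: (eqVneq i.+1 j) => [eq1|neq1]; first by apply/leF1/A_empty; lia.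
    have := @nattr i.+1 j; rewrite aj natt1 => natt2.
    have -> : m = m.-1.+1 by lia.
    by apply: segment_bound => //; lia.
  have uj := negbT aj; case aj1 : (att j.-2); last by rewrite stripr ?aj1.
  have lt1 : i < j.-1.
    by rewrite ltnNge; apply: contraFN aj => le_ji; rewrite (_ : j.-1 = i) //; lia.
  have leaf : A i j <= A i (j - 3) by apply: A_leafr => //; lia.
  (* The outer segment loses the attached [j.-2] by trimming on the right, and the inner one lacks
     the attached [i]. *)
  apply: two; last first.
    by apply: segment_bound => //; rewrite -natt1; apply/leq_nattr/leq_pred.
  apply: leq_trans leaf (segment_bound _ _ _) => //; first by lia.
  have : natt i (j - 3) <= natt i j.-2 by apply: leq_nattr; lia.
  by have := nattr lt1; rewrite -nattr0 // aj1; lia.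
have ui := negbT ai; case ai1 : (att i.+1); last by rewrite stripl ?ai1.
have lt1 : i.+1 < j.
  by rewrite ltnNge; apply/negP => /natt_geq; rewrite -nattl0 // natt_ij.
have natt2 : natt i.+2 j = m.
  by have := nattl lt1; rewrite -nattl0 // ai1; lia.
have leaf : A i j <= A i.+3 j by apply: A_leafl.
case aj : (att j.-1).
  apply: two.
    apply: leq_trans leaf (segment_bound _ _ _) => //.
    by rewrite -natt2; apply: leq_nattl.
  apply: segment_bound => //.
  by have := nattr lt1; rewrite -nattl0 // aj; lia.
have uj := negbT aj; case aj1 : (att j.-2); last by rewrite stripr ?aj1.
(* Both ends are unattached with attached neighbours [i.+1] and [j.-2]. Trimming the outer segment
   on both sides removes these two, which compensates for the weak bound [interior]. *)
apply: lower_bounds => //; apply: leq_trans leaf _.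
have lt2 : i.+1 < j.-1.
  rewrite ltnNge; apply: contraFN aj => le_ji.
  by rewrite (_ : j.-1 = i.+1) //; lia.
case: (leqP j i.+3) => [le_j3|lt3]; first exact/leF1/A_empty.
case: (eqVneq i.+4 j) => [eq4|neq4].
  by rewrite -eq4 A_single //; [lia|rewrite -eq4 in uj].
have leaf3 : A i.+3 j <= A i.+3 (j - 3) by apply: A_leafr => //; lia.
have natt3 : natt i.+2 j.-1 = m by rewrite -nattr0.
have := @nattr i.+2 j.-1; rewrite natt3 aj1 => natt4.
have -> : m = m.-1.+1 by lia.
apply: leq_trans leaf3 (segment_bound _ _ _) => //; first by lia.
have : natt i.+3 (j - 3) <= natt i.+2 (j - 3) by apply: leq_nattl.
have : natt i.+2 (j - 3) <= natt i.+2 j.-2 by apply: leq_nattr; lia.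
by lia.
Qed.
End Segments.

Lemma leq_lucas m n : m <= n -> 0 < m -> lucas m <= lucas n.
Proof. by move=> le_mn m0; rewrite /lucas leq_add ?leq_fib //; lia. Qed.

(** * Segments of an induced cycle with part of the outside graph *)

Section Cycle.
Variables (T : finType) (e : rel T) (C : {set T}) (k : nat) (g : nat -> T) (c : nat).
Hypothesis simple_e : simple_graph e.
Hypothesis ge3_k : 3 <= k.
Hypothesis g_inj : forall s t, s < k -> t < k -> g s = g t -> s = t.
Hypothesis g_adj : forall s t, s < k -> t < k ->
  e (g s) (g t) = (t == s.+1 %% k) || (s == t.+1 %% k).
Hypothesis C_def : C = [set g (val t) | t : 'I_k].
Hypothesis cmin_c : forall S : {set T}, S \subset ~: C -> cmin e S <= c.

Definition attached x := [exists y, (y \notin C) && e x y].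
Definition segment i j := [set g (val t) | t : 'I_k & i <= t < j].
(** Removing a closed neighbourhood may also shrink the part outside [C]; the maximum over [S] keeps
    the recursion closed under this. *)
Definition segment_cmin i j :=
  \max_(S : {set T} | S \subset ~: C) cmin e (S :|: segment i j).

Local Notation A := segment_cmin.

Lemma mem_segment i j t : t < k -> (g t \in segment i j) = (i <= t < j).
Proof.
move=> lt_tk; apply/imsetP/idP => [[s + eq_g]|t_ij].
  by rewrite inE (g_inj lt_tk (ltn_ord s) eq_g).
by exists (Ordinal lt_tk); rewrite ?inE.
Qed.

Lemma mem_cycle t : t < k -> g t \in C.
Proof. by move=> lt_tk; rewrite C_def; apply/imsetP; exists (Ordinal lt_tk). Qed.

Lemma cycleP x : reflect (exists2 t, t < k & x = g t) (x \in C).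
Proof.
apply: (iffP idP) => [|[t lt_tk ->]]; last exact: mem_cycle.
by rewrite C_def => /imsetP[t _ ->]; exists t.
Qed.

Lemma segmentP i j x : x \in segment i j -> exists t, [/\ t < k, i <= t < j & x = g t].
Proof.
by case/imsetP=> t; rewrite inE => t_ij ->; exists t; rewrite ltn_ord.
Qed.

Lemma segment_sub i j : segment i j \subset C.
Proof. by apply/subsetP => _ /segmentP[t [lt_tk _ ->]]; apply: mem_cycle. Qed.

Lemma segment_geq i j : j <= i -> segment i j = set0.
Proof.
move=> le_ji; apply/setP => x; rewrite in_set0; apply/imsetP => -[t].
by rewrite inE; lia.
Qed.

(** Leaving out index 0 leaves out the wrap-around edge, so the rest of the cycle is a path. *)
Lemma inner_adj s t : 0 < s < k -> 0 < t < k ->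
  e (g s) (g t) = (t == s.+1) || (s == t.+1).
Proof.
have succ a b : 0 < a < k -> 0 < b < k -> (b == a.+1 %% k) = (b == a.+1).
  move=> a_k b_k; case: (eqVneq a.+1 k) => [eq_ak|neq_ak]; last by rewrite modn_small //; lia.
  by rewrite eq_ak modnn; lia.
by move=> s_k t_k; rewrite g_adj ?succ //; lia.
Qed.

Lemma unattached_adj (S : {set T}) x y :
  S \subset ~: C -> ~~ attached x -> y \in S -> ~~ e x y.
Proof.
move=> /subsetP SC un_x /SC; rewrite inE => yC.
by apply: contra un_x => xy; apply/existsP; exists y; rewrite yC.
Qed.

Lemma cmin_segment (S : {set T}) i j : S \subset ~: C -> cmin e (S :|: segment i j) <= A i j.
Proof.
by move=> SC; apply: (leq_bigmax_cond (F := fun S => cmin e (S :|: segment i j))).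
Qed.

Lemma notin_outside (S : {set T}) t : S \subset ~: C -> t < k -> (g t \in S) = false.
Proof.
by move=> /subsetP SC lt_tk; apply/negP => /SC; rewrite inE mem_cycle.
Qed.

(** Inside the segment exactly the indices [t.-1], [t] and [t.+1] disappear; right ends are
    exclusive, so the left piece stops before [t.-1]. *)
Lemma segment_delete_nbrs (S : {set T}) i j t :
  S \subset ~: C -> 0 < i -> j <= k -> i <= t < j ->
  (S :|: segment i j) :\: (g t |: [set y | e (g t) y]) =
  (S :\: [set y | e (g t) y]) :|: (segment i t.-1 :|: segment t.+2 j).
Proof.
move=> SC i0 jk t_ij; have lt_tk : t < k by lia.
have segF x a b : x \notin C -> (x \in segment a b) = false.
  by move=> xC; apply: contraNF xC; apply/subsetP/segment_sub.
apply/setP => x; rewrite !(in_setU, in_setD, in_set1).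
have [/cycleP[s lt_sk ->]|xC] := boolP (x \in C); last first.
  rewrite !segF // !orbF inE; case: eqP => // eq_x.
  by rewrite eq_x mem_cycle in xC.
rewrite !(notin_outside SC) // !mem_segment // andbF inE /=.
have -> : (g s == g t) = (s == t) by apply/eqP/eqP => [/g_inj->|->].
case: (posnP s) => [->|s0]; first by case: (i) i0 => // ? _; rewrite andbF.
rewrite inner_adj; lia.
Qed.

Lemma segment_cmin_empty i j : j <= i -> A i j <= c.
Proof.
by move=> le_ji; apply/bigmax_leqP => S SC; rewrite segment_geq // setU0 cmin_c.
Qed.

Lemma segment_cmin_branch i j : 0 < i -> j <= k -> i < j ->
  A i j <= A i.+1 j + A i.+2 j.
Proof.
move=> i0 jk lt_ij; apply/bigmax_leqP => S SC.
have lt_ik : i < k by lia.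
apply: leq_trans (cmin_split simple_e (v := g i) _) _.
  by rewrite in_setU mem_segment // leqnn lt_ij orbT.
rewrite segment_delete_nbrs ?leqnn // (segment_geq (leq_pred i)) set0U.
apply: leq_add; last by apply/cmin_segment/(subset_trans _ SC)/subsetDl.
suff -> : (S :|: segment i j) :\ g i = S :|: segment i.+1 j by apply: cmin_segment.
apply/setP => x; rewrite !(in_setU, in_setD1).
have [/cycleP[s lt_sk ->]|xC] := boolP (x \in C).
  rewrite (notin_outside SC) // !mem_segment //=.
  by have -> : (g s == g i) = (s == i) by [apply/eqP/eqP => [/g_inj->|->]]; lia.
have segF a b : (x \in segment a b) = false.
  by apply: contraNF xC; apply/subsetP/segment_sub.
rewrite !segF !orbF; case: eqP => // eq_x.
by rewrite eq_x mem_cycle in xC.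
Qed.

Lemma segment_cmin_single i : 0 < i -> i < k -> ~~ attached (g i) -> A i i.+1 = 0.
Proof.
move=> i0 lt_ik un_i; apply/eqP; rewrite -leqn0; apply/bigmax_leqP => S SC.
rewrite (cmin_isolated simple_e (u := g i)) //.
  by rewrite in_setU mem_segment // leqnn ltnSn orbT.
move=> x /setUP[xS|/segmentP[t [_ t_i ->]]]; first exact: unattached_adj xS.
by rewrite (_ : t = i) ?simple_e.2 //; lia.
Qed.

(** An unattached [g s] has no neighbour in [S], so [g t] is its only neighbour and [cmin_leaf]
    applies. Keeping [s] and [t] general covers both ends of a segment. *)
Lemma segment_leaf (S : {set T}) i j s t :
  S \subset ~: C -> 0 < i -> j <= k -> i <= s < j -> i <= t < j ->
  (t == s.+1) || (s == t.+1) -> ~~ attached (g s) ->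
  (forall r, i <= r < j -> (r == s.+1) || (s == r.+1) -> r = t) ->
  cmin e (S :|: segment i j) <=
  cmin e ((S :\: [set y | e (g t) y]) :|: (segment i t.-1 :|: segment t.+2 j)).
Proof.
move=> SC i0 jk s_ij t_ij adj_st un_s leaf_s.
have [lt_sk lt_tk] : s < k /\ t < k by lia.
rewrite -segment_delete_nbrs //; apply: (cmin_leaf simple_e (u := g s)).
- by rewrite in_setU mem_segment // s_ij orbT.
- by rewrite in_setU mem_segment // t_ij orbT.
- by rewrite inner_adj //; lia.
move=> x /setUP[xS|/segmentP[r [lt_rk r_ij ->]]].
  by rewrite (negPf (unattached_adj SC un_s xS)).
rewrite inner_adj; [|lia|lia].
by move=> /(leaf_s _ r_ij) ->.
Qed.

Lemma segment_cmin_leafl i j : 0 < i -> j <= k -> i.+1 < j -> ~~ attached (g i) ->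
  A i j <= A i.+3 j.
Proof.
move=> i0 jk lt_ij un_i; apply/bigmax_leqP => S SC.
apply: leq_trans (segment_leaf (s := i) (t := i.+1) SC i0 jk _ _ _ un_i _) _; try lia.
rewrite /= (segment_geq (leqnn i)) set0U.
by apply/cmin_segment/(subset_trans _ SC)/subsetDl.
Qed.

Lemma segment_cmin_leafr i j : 0 < i -> j <= k -> i.+1 < j -> ~~ attached (g j.-1) ->
  A i j <= A i (j - 3).
Proof.
move=> i0 jk lt_ij un_j; apply/bigmax_leqP => S SC.
apply: leq_trans (segment_leaf (s := j.-1) (t := j.-2) SC i0 jk _ _ _ un_j _) _; try lia.
rewrite (_ : j.-2.-1 = j - 3) ?(@segment_geq _ j) ?setU0; [|lia|lia].
by apply/cmin_segment/(subset_trans _ SC)/subsetDl.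
Qed.

Lemma cmin_cycle_branch : cmin e setT <= A 1 k + A 2 k.-1.
Proof.
have k0 : 0 < k by lia.
apply: leq_trans (cmin_split simple_e (in_setT (g 0))) _.
have segF x a b : x \notin C -> (x \in segment a b) = false.
  by move=> xC; apply: contraNF xC; apply/subsetP/segment_sub.
have -> : [set: T] :\ g 0 = ~: C :|: segment 1 k.
  apply/setP => x; rewrite !inE andbT.
  have [/cycleP[s lt_sk ->]|xC] := boolP (x \in C).
    rewrite mem_segment //=.
    by have -> : (g s == g 0) = (s == 0) by [apply/eqP/eqP => [/g_inj->|->]]; lia.
  by apply: contraNneq xC => ->; apply: mem_cycle.
have -> : [set: T] :\: (g 0 |: [set y | e (g 0) y]) =
    (~: C :\: [set y | e (g 0) y]) :|: segment 2 k.-1.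
  apply/setP => x; rewrite !inE andbT.
  have [/cycleP[s lt_sk ->]|xC] := boolP (x \in C).
    rewrite mem_segment //= andbF /= g_adj //.
    have -> : (g s == g 0) = (s == 0) by apply/eqP/eqP => [/g_inj->|->].
    (* The neighbours of [g 0] on the cycle are those of index 1 and, by wrap-around, [k.-1]. *)
    rewrite (modn_small (m := 1)); last by lia.
    case: (eqVneq s.+1 k) => [eq_sk|neq_sk]; first by rewrite eq_sk modnn; lia.
    by rewrite modn_small; lia.
  rewrite segF // orbF andbT; case: eqP => // eq_x.
  by rewrite eq_x mem_cycle in xC.
by apply: leq_add; apply: cmin_segment; rewrite ?subsetDl.
Qed.

Lemma n_attach_cycle :
  n_attach e C = attached (g 0) + natt (attached \o g) 1 k.
Proof.
have k0 : 0 < k by lia.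
rewrite -[RHS](nattl (attached \o g) k0) /natt big_mkord.
have -> : \sum_(t < k) (attached \o g) t = #|[set t : 'I_k | attached (g t)]|.
  by rewrite -sum1dep_card [RHS]big_mkcond; apply: eq_bigr => t _ /=; case: attached.
rewrite -(card_in_imset (f := fun t : 'I_k => g t)); last first.
  by move=> s t _ _ /g_inj eq_st; apply/val_inj/eq_st.
congr #|pred_of_set _|; apply/setP => x; rewrite inE.
apply/andP/imsetP => [[/cycleP[t lt_tk ->] att_t]|[t + ->]].
  by exists (Ordinal lt_tk); rewrite ?inE.
by rewrite inE => att_t; rewrite mem_cycle.
Qed.

(** The last hypothesis places an attached vertex at the branching index 0 if the remaining path has
    any, so the total count exceeds that of the path by one. *)
Lemma cmin_cycle_bound n : 2 <= n -> n_attach e C <= n ->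
  (0 < natt (attached \o g) 1 k -> attached (g 0)) ->
  cmin e setT <= c * lucas n.
Proof.
rewrite n_attach_cycle => n2 le_n att0; apply: leq_trans cmin_cycle_branch _.
have bound := @segment_bound (attached \o g) A k c
  (fun i j _ _ => @segment_cmin_empty i j) segment_cmin_branch
  segment_cmin_single segment_cmin_leafl.
have bound2 := @segment_and_interior_bound (attached \o g) A k c
  (fun i j _ _ => @segment_cmin_empty i j) segment_cmin_branch
  segment_cmin_single segment_cmin_leafl segment_cmin_leafr.
case natt1 : (natt (attached \o g) 1 k) => [|m].
  (* Without attached vertices on the path each summand is at most [c], and 2 is below the Lucas
     number 3 at index 2; this uses [2 <= n]. *)
  have natt2 : natt (attached \o g) 2 k.-1 <= 0.
    by rewrite -natt1; apply: leq_trans (leq_nattl _ _ _) (leq_nattr _ _ (leq_pred k)).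
  have le1 : A 1 k <= c by rewrite -[c]muln1 (bound _ _ 0) ?natt1.
  have le2 : A 2 k.-1 <= c by rewrite -[c]muln1 (bound _ _ 0) ?leq_pred.
  have : c * 3 <= c * lucas n by rewrite leq_mul2l (@leq_lucas 2) ?orbT.
  lia.
apply: leq_trans (bound2 1 k m _ _ natt1) _ => //.
rewrite -mulnDr leq_mul2l; apply/orP; right.
have -> : fib m.+3 + fib m.+1 = lucas m.+2 by rewrite addnC.
by apply: leq_lucas => //; move: le_n; rewrite natt1 att0 ?natt1.
Qed.

End Cycle.

Theorem theorem3p4 (T : finType) (e : rel T) (C : {set T}) (n c : nat) :
  simple_graph e ->
  induced_cycle e C ->
  2 <= n ->
  n_attach e C <= n ->
  (forall S : {set T}, S \subset ~: C -> cmin e S <= c) ->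
  cmin e [set: T] <= c * lucas n.
Proof.
move=> simple_e [k [f [ge3_k f_inj C_def f_adj]]] n2 le_n cmin_c.
have k0 : 0 < k by lia.
(* The cycle is rotated to start at [f i], so that any vertex can serve as the branching vertex. *)
pose g (i : 'I_k) t := f (Ordinal (ltn_pmod (t + i) k0)).
have bound i : (0 < natt (attached e C \o g i) 1 k -> attached e C (g i 0)) ->
    cmin e [set: T] <= c * lucas n.
  have g_inj s t : s < k -> t < k -> g i s = g i t -> s = t.
    move=> lt_s lt_t /f_inj/(congr1 val)/eqP /=.
    by rewrite eqn_modDr !modn_small // => /eqP.
  apply: cmin_cycle_bound => //.
    move=> s t lt_s lt_t; rewrite /g f_adj /=.
    rewrite -![(_ %% k).+1]addn1 !modnDml ![_ + i + 1]addnAC !eqn_modDr !addn1.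
    by rewrite !(modn_small lt_s, modn_small lt_t).
  apply/eqP; rewrite eq_sym eqEcard; apply/andP; split.
    by apply/subsetP => _ /imsetP[t _ ->]; rewrite C_def imset_f.
  rewrite C_def !card_in_imset ?cardsT // => s t _ _; last exact: f_inj.
  by move=> /(g_inj _ _ (ltn_ord s) (ltn_ord t))/val_inj.
(* The rotation starts at an attached vertex if there is one; otherwise every path count is 0 and
   any start will do. *)
case: (pickP (fun i : 'I_k => attached e C (f i))) => [i att_i|none].
  apply: (bound i) => _; rewrite /g (_ : Ordinal _ = i) //.
  by apply: val_inj; rewrite /= add0n modn_small.
apply: (bound (Ordinal k0)).
by rewrite /natt big1 // => t _; rewrite /= /g none.
Qed.
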